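(* Assume $\beta(x)\neq 0$ and let $C$ be an ideal of $\mathcal{R}_2=\frac{GR(p^2,m)[x]}{\langle f(x)\rangle}$. Let $k,\ell,n<t$ be nonnegative integers with $n<k$, and let $\delta(x)=\sum_{j=0}^{k-1-\ell}\eta_j(x)h(x)^j$ where $\eta_j(x)\in\mathcal{T}_m[x]$, $\eta_0(x)\ne0$ and $\deg\eta_j(x)<\deg h(x)$ (so $\ell<k$). Put $z=\min\left(\{j:\gamma_j(x)\ne\eta_j(x)\}\cup\{t\}\right)$. (1) If $C=\langle h(x)^k\rangle$, then $T_0(C)=k$ and $T_1(C)=\min(k,v)$. (2) If $C=\langle h(x)^k+ph(x)^\ell\delta(x)\rangle$, then $T_0(C)=k$ and $$T_1(C)=\begin{cases}\min(k,v,t-k+\ell)&\text{if }v\ne t-k+\ell,\\ \min(k,v+z)&\text{if }v=t-k+\ell.\end{cases}$$ (3) If $C=\langle h(x)^k,\ ph(x)^n\rangle$, then $T_0(C)=k$ and $T_1(C)=\min(k,v,n)$. (4) If $C=\langle h(x)^k+ph(x)^\ell\delta(x),\ ph(x)^n\rangle$, then $T_0(C)=k$ and $$T_1(C)=\begin{cases}\min(k,v,t-k+\ell,n)&\text{if }v\ne t-k+\ell,\\ \min(k,v+z,n)&\text{if }v=t-k+\ell.\end{cases}$$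
   Context: $p$ is a prime, $m\ge 1$; $GR(p^2,m)$ is the Galois ring of characteristic $p^2$ with $p^{2m}$ elements, with maximal ideal $\langle p\rangle$ and residue field $\mathbb{F}_{p^m}$; $\mu$ (or a bar) denotes reduction modulo $p$. $\mathcal{T}_m=\{0,1,\zeta,\dots,\zeta^{p^m-2}\}\subset GR(p^2,m)$ is the Teichmüller set ($\zeta$ of multiplicative order $p^m-1$), and $\mathcal{T}_m[x]$ the set of polynomials with coefficients in $\mathcal{T}_m$. Standing assumption: $f(x)\in GR(p^2,m)[x]$ is a monic regular (not a zero divisor) primary (generating a primary ideal) polynomial, not a unit, of the form $f(x)=h(x)^t+p\beta(x)$ with $t\ge1$, $h(x)$ monic basic irreducible (irreducible with irreducible reduction modulo $p$), and $\beta(x)=0$ or $\deg\beta(x)<t\deg h(x)$. When $\beta(x)\ne0$ it is written $\beta(x)=h(x)^v\beta'(x)$ with $0\le v<t$ and $\beta'(x)=\sum_{j=0}^{t-1-v}\gamma_j(x)h(x)^j$, where $\gamma_j(x)\in\mathcal{T}_m[x]$, $\deg\gamma_j(x)<\deg h(x)$, and $\gamma_0(x)\ne0$. (When $v=t-k+\ell$, the index ranges of the $\gamma_j$ and the $\eta_j$ coincide.) Torsional degrees: for an ideal $C$ of $\mathcal{R}_2$ and $i\in\{0,1\}$, $\mathrm{Tor}_i(C)=\{\mu(v): v\in\mathcal{R}_2,\ p^iv\in C\}$ is an ideal of $\mathbb{F}_{p^m}[x]/\langle\overline f(x)\rangle=\mathbb{F}_{p^m}[x]/\langle\overline h(x)^t\rangle$,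 hence equals $\langle \overline h(x)^{T_i}\rangle$ for a unique $0\le T_i\le t$; $T_i(C):=T_i$. *)

(* Defs.v *)
From mathcomp Require Import all_boot all_order all_algebra all_field.
From mathcomp Require Import boolp classical_sets.

Set Implicit Arguments.
Unset Strict Implicit.
Unset Printing Implicit Defensive.

Import GRing.Theory.
Local Open Scope ring_scope.

(* Invertibility without a unitRingType structure: polynomials over a ring
   with zero divisors carry none. *)
Definition invertible (A : comNzRingType) (a : A) : Prop :=
  exists b, a * b = 1.

(* R is the Galois ring GR(p^2, m): a finite commutative ring of
   characteristic p^2 with p^(2m) elements, whose non-units are exactly the
   elements of <p>.  This determines R up to isomorphism. *)
Record galois_ring_p2 (p m : nat) (R : finComNzRingType) : Prop := {
  galois_ring_char : forall n : nat, (n%:R == 0 :> R) = (p ^ 2 %| n)%N;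
  galois_ring_card : #|R| = (p ^ (2 * m))%N;
  galois_ring_max_ideal :
    forall x : R, ~ invertible x <-> exists y, x = p%:R * y }.

(* mu is (a model of) the reduction R -> R / <p> onto the residue field. *)
Record residue_map (p : nat) (R : finComNzRingType) (F : finFieldType)
    (mu : {rmorphism R -> F}) : Prop := {
  residue_map_surj : forall y : F, exists x, mu x = y;
  residue_map_ker : forall x : R, mu x = 0 <-> exists y, x = p%:R * y }.

(* {0, 1, zeta, ..., zeta^(q - 2)}, used with q = p^m. *)
Definition teichmuller (R : finComNzRingType) (q : nat) (zeta : R) : {pred R} :=
  fun a => (a == 0) || [exists i : 'I_q.-1, a == zeta ^+ i].

Definition irreducible_elt (A : comNzRingType) (a : A) : Prop :=
  ~ invertible a /\
  forall b c, a = b * c -> invertible b \/ invertible c.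

Definition basic_irreducible (R : finComNzRingType) (F : finFieldType)
    (mu : {rmorphism R -> F}) (h : {poly R}) : Prop :=
  irreducible_elt h /\ irreducible_poly (map_poly mu h).

Definition in_pideal (A : comNzRingType) (a x : A) : Prop :=
  exists b, x = b * a.

(* <a> is a primary ideal.  The exponent n = 0 is harmless, since
   b ^+ 0 = 1 does not belong to the proper ideal <a>. *)
Definition primary_elt (A : comNzRingType) (a : A) : Prop :=
  ~ in_pideal a 1 /\
  forall b c, in_pideal a (b * c) ->
    in_pideal a b \/ exists n, in_pideal a (c ^+ n).

(* Unlike idealr_closed in ring_quotient, the unit ideal is allowed. *)
Definition is_ideal (A : comNzRingType) (C : set A) : Prop :=
  C 0 /\ forall a u v, C u -> C v -> C (a * u + v).

Definition ideal_gen (A : comNzRingType) (s : seq A) : set A :=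
  [set x | exists c : 'I_(size s) -> A, x = \sum_(i < size s) c i * s`_i]%classic.

Section Torsion.
Variables (p : nat) (R : finComNzRingType) (F : finFieldType).
Variables (mu : {rmorphism R -> F}) (f : {poly R}).

(* {poly %/ f} is R[x] / <f> because f is monic of positive degree; its
   elements are the remainders modulo f, so the reduction
   R[x] / <f> -> F[x] / <mu f> acts on that representative. *)
Definition red_quot (u : {poly %/ f}) : {poly %/ map_poly mu f} :=
  in_qpoly (map_poly mu f) (map_poly mu (u : {poly R})).

Definition Tor (i : nat) (C : set {poly %/ f}) : set {poly %/ map_poly mu f} :=
  [set red_quot u | u in [set u | C (p%:R ^+ i * u)]]%classic.

(* The T <= t with Tor_i(C) = < mu(h)^T >.  The value t.+1 is a placeholder
   for the absence of such a T, which does not occur for an ideal C when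
   mu(f) = mu(h)^t. *)
Definition torsional_degree (h : {poly R}) (t i : nat)
    (C : set {poly %/ f}) : nat :=
  xget t.+1 [set T : nat | (T <= t)%N /\
    Tor i C = ideal_gen [:: in_qpoly (map_poly mu f) (map_poly mu h ^+ T)]]%classic.

End Torsion.

(* Main.v *)
Require Import Defs.
From mathcomp Require Import all_boot all_order all_algebra all_field.
From mathcomp Require Import boolp classical_sets ring zify.

Set Implicit Arguments.
Unset Strict Implicit.
Unset Printing Implicit Defensive.

Import GRing.Theory.
Local Open Scope ring_scope.

(** Write hb, betab, ... for the reductions modulo p, so that fb = hb ^+ t.
    Every ideal in question has the form
    C = < h ^+ k + p eps, p h ^+ n > with n <= k < t: a principal ideal is the
    case n = k, because p (h ^+ k + p eps) = p h ^+ k.  Reducing C modulo p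
    leaves < hb ^+ k >, hence T_0 = k ([torsional_degree0]).

    For T_1, suppose that p u = c (h ^+ k + p eps) + b p h ^+ n + e f.
    Modulo p this says c = - e h ^+ (t - k); so c = p c' - e h ^+ (t - k) for
    some c'.  As f = h ^+ t + p beta, the e-terms in h ^+ t cancel, a factor p
    can be removed, and
      ub = e (betab - hb ^+ (t - k) epsb) + b hb ^+ n  modulo hb ^+ k.
    Thus Tor_1(C) is generated by D = betab - hb ^+ (t - k) epsb and hb ^+ n
    ([torsion1_mem]).  Since hb is irreducible, T_1 is the minimum of n and of
    the hb-adic valuation d of D ([ideal_primary_power]).

    It remains to find d.  For eps = 0 we have D = betab, of valuation v.
    For eps = h ^+ l delta we have
      D = hb ^+ v betab' - hb ^+ (t - k + l) deltab,
    where betab' and deltab are prime to hb: their expansions in base hb have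
    a nonzero digit of index 0 ([lowest_digit]).  If v and t - k + l differ,
    then d is the smaller one.  If they agree, then D is hb ^+ v times the
    expansion whose digits are the reductions of gamma_j - eta_j; reduction is
    injective on Teichmueller elements ([teichmuller_inj]), so the first nonzero
    digit is the first place z at which gamma and eta differ. *)

(** * Quotients of polynomial rings and their ideals *)

Lemma mk_monicE (A : nzRingType) (f : {poly A}) :
  f \is monic -> (1 < size f)%N -> mk_monic f = f.
Proof. by rewrite /mk_monic => -> ->. Qed.

Lemma in_qpolyK (A : nzRingType) (f : {poly A}) (u : {poly %/ f}) :
  in_qpoly f (u : {poly A}) = u.
Proof. by exact/val_inj/in_qpoly_small/size_mk_monic. Qed.

Lemma in_qpoly_eqP (A : comNzRingType) (f a b : {poly A}) :
  f \is monic -> (1 < size f)%N ->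
  in_qpoly f a = in_qpoly f b <-> exists c, a = b + c * f.
Proof.
move=> fm sf; split=> [/(congr1 val) /=|[c ->]].
  rewrite mk_monicE // => eq_ab.
  exists (Pdiv.CommonRing.rdivp a f - Pdiv.CommonRing.rdivp b f).
  rewrite {1}(Pdiv.RingMonic.rdivp_eq fm a) {1}(Pdiv.RingMonic.rdivp_eq fm b).
  by rewrite eq_ab mulrBl addrAC addrCA addrN addr0.
apply: val_inj => /=; rewrite mk_monicE // Pdiv.RingMonic.rmodpD //.
by rewrite Pdiv.RingMonic.rmodp_mull // addr0.
Qed.

Lemma ideal_gen1P (A : comNzRingType) (a x : A) :
  ideal_gen [:: a] x <-> exists c, x = c * a.
Proof.
split=> [[c ->]|[c ->]]; last by exists (fun=> c); rewrite big_ord1.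
by exists (c ord0); rewrite big_ord1.
Qed.

Lemma ideal_gen2P (A : comNzRingType) (a b x : A) :
  ideal_gen [:: a; b] x <-> exists c d, x = c * a + d * b.
Proof.
split=> [[c ->]|[c [d ->]]].
  by exists (c ord0), (c (lift ord0 ord0)); rewrite big_ord_recl big_ord1.
by exists (fun i => if i == ord0 then c else d); rewrite big_ord_recl big_ord1.
Qed.

Lemma ideal_gen_absorb (A : comNzRingType) (a c : A) :
  ideal_gen [:: a] = ideal_gen [:: a; c * a].
Proof.
apply/seteqP; split=> x; rewrite ideal_gen1P ideal_gen2P.
  by case=> d ->; exists d, 0; rewrite mul0r addr0.
by case=> d [e ->]; exists (d + e * c); rewrite mulrDl mulrA.
Qed.

Lemma ideal_gen2_qpolyP (A : comNzRingType) (f a b u : {poly A}) :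
  f \is monic -> (1 < size f)%N ->
  ideal_gen [:: in_qpoly f a; in_qpoly f b] (in_qpoly f u) <->
  exists c d e, u = c * a + d * b + e * f.
Proof.
move=> fm sf; rewrite ideal_gen2P; split=> [[c [d]]|[c [d [e ->]]]].
  rewrite -(in_qpolyK c) -(in_qpolyK d) -!in_qpolyM -in_qpolyD.
  by move=> /(in_qpoly_eqP _ _ fm sf) [e ->]; exists (polyn c), (polyn d), e.
exists (in_qpoly f c), (in_qpoly f d); rewrite -!in_qpolyM -in_qpolyD.
by apply/in_qpoly_eqP => //; exists e.
Qed.

(** * Valuations at an irreducible polynomial *)

Section Valuation.
Variables (F : fieldType) (h : {poly F}).
Hypothesis h_irr : irreducible_poly h.

Let h_gt1 : (1 < size h)%N. Proof. by case: h_irr. Qed.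
Let h_neq0 : h != 0. Proof. exact: irredp_neq0. Qed.

(** If d < n, then w is prime to h, and Bezout for w and h ^+ (n - d) writes
    h ^+ d as a combination of the two generators.  If n <= d, the first
    generator is a multiple of the second for any w, even w = 0; hence the
    guarded hypothesis. *)
Lemma ideal_primary_power (d n : nat) (w x : {poly F}) :
  ((d < n)%N -> ~~ (h %| w)) ->
  (exists a b, x = a * (h ^+ d * w) + b * h ^+ n) <-> h ^+ minn d n %| x.
Proof.
move=> w_unit; split=> [[a [b ->]]|].
  apply: dvdp_add; apply: dvdp_mull; last by rewrite dvdp_exp2l // geq_minr.
  by apply: dvdp_mulr; rewrite dvdp_exp2l // geq_minl.
case: (ltnP d n) w_unit => [dn|nd] w_unit /dvdpP [y ->]; last first.
  by exists 0, y; rewrite mul0r add0r.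
have : coprimep w (h ^+ (n - d)).
  by apply: coprimep_expr; rewrite coprimep_sym irreducible_poly_coprime // w_unit.
case/Bezout_eq1_coprimepP => -[a b] /= ab.
exists (y * a), (y * b).
have -> : h ^+ n = h ^+ d * h ^+ (n - d) by rewrite -exprD subnKC // ltnW.
by rewrite -[LHS]mulr1 -ab mulrDr; congr (_ + _); rewrite mulrACA.
Qed.

(** The quotient of the sum by h ^+ z is a z modulo h, and h cannot divide the
    nonzero a z, which has smaller degree. *)
Lemma lowest_digit (N z : nat) (a : nat -> {poly F}) :
  (forall j, (j < N)%N -> (size (a j) < size h)%N) ->
  (z < N)%N -> a z != 0 -> (forall j, (j < z)%N -> a j = 0) ->
  exists2 w, \sum_(j < N) a j * h ^+ j = h ^+ z * w & ~~ (h %| w).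
Proof.
move=> sz_a zN az_neq0 a_low.
exists (a z + h * \sum_(z.+1 <= j < N) a j * h ^+ (j - z.+1)).
  rewrite -(big_mkord xpredT (fun j => a j * h ^+ j)) (big_cat_nat (n := z)) //=;
    last exact: ltnW.
  rewrite big_nat big1 => [|j jz]; last by rewrite a_low ?mul0r //; case/andP: jz.
  rewrite add0r big_ltn // mulrDr mulrC; congr (_ + _).
  rewrite mulrA mulr_sumr big_nat [RHS]big_nat; apply: eq_bigr => j /andP [zj _].
  by rewrite -exprSr mulrCA -exprD subnKC.
rewrite dvdp_addl ?dvdp_mulr //; apply: contraL (sz_a z zN) => ha.
by rewrite -leqNgt dvdp_leq.
Qed.

Lemma valuation_sub (v s : nat) (w1 w2 : {poly F}) :
  ~~ (h %| w1) -> ~~ (h %| w2) -> v != s ->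
  exists2 w, h ^+ v * w1 - h ^+ s * w2 = h ^+ minn v s * w & ~~ (h %| w).
Proof.
have aux i j (x y : {poly F}) : ~~ (h %| x) -> (i < j)%N ->
    exists2 w, h ^+ i * x - h ^+ j * y = h ^+ i * w & ~~ (h %| w).
  move=> hx ij; exists (x - h ^+ (j - i) * y).
    by rewrite mulrBr mulrA -exprD subnKC // ltnW.
  by rewrite dvdp_subl // dvdp_mulr // dvdp_exp ?subn_gt0.
move=> hw1 hw2; rewrite neq_ltn => /orP[vs|sv].
  by case: (aux _ _ w1 w2 hw1 vs) => w; exists w => //; rewrite (minn_idPl (ltnW vs)).
case: (aux _ _ w2 w1 hw2 sv) => w eq_w hw; exists (- w); last by rewrite dvdpNr.
by rewrite (minn_idPr (ltnW sv)) mulrN -eq_w opprB.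
Qed.

End Valuation.

(** * Teichmüller representatives *)

Section Teichmuller.
Variables (p m : nat) (R : finComNzRingType) (F : finFieldType).
Variables (mu : {rmorphism R -> F}).
Hypotheses (R_galois : galois_ring_p2 p m R) (mu_res : residue_map p mu).

Lemma residue_map_p : mu p%:R = 0.
Proof. by apply/(residue_map_ker mu_res); exists 1; rewrite mulr1. Qed.

Lemma galois_ring_p2_eq0 : p%:R * p%:R = 0 :> R.
Proof. by apply/eqP; rewrite -natrM (galois_ring_char R_galois) expnS expn1. Qed.

(** In a ^+ p - b ^+ p = (a - b) * \sum_i a ^+ (p.-1 - i) * b ^+ i both factors
    lie in <p>: the second one reduces to p copies of one element.  Since p ^ 2
    is zero in R, the product vanishes. *)
Lemma expr_residue_eq (a b : R) : mu a = mu b -> a ^+ p = b ^+ p.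
Proof.
move=> eq_ab; apply/eqP; rewrite -subr_eq0 subrXX; apply/eqP.
have /(residue_map_ker mu_res) [y ->] : mu (a - b) = 0.
  by rewrite rmorphB eq_ab subrr.
have /(residue_map_ker mu_res) [w ->] :
    mu (\sum_(i < p) a ^+ (p.-1 - i) * b ^+ i) = 0.
  rewrite rmorph_sum /= (eq_bigr (fun=> mu b ^+ p.-1)) => [|i _].
    by rewrite sumr_const card_ord -mulr_natl -(rmorph_nat mu) residue_map_p mul0r.
  rewrite rmorphM !rmorphXn eq_ab -exprD subnK //.
  by rewrite -ltnS (ltn_predK (ltn_ord i)).
by rewrite mulrACA galois_ring_p2_eq0 mul0r.
Qed.

Variable zeta : R.
Hypotheses (p_prime : prime p) (m_ge1 : (1 <= m)%N).
Hypothesis zeta_prim : (p ^ m).-1.-primitive_root zeta.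

Lemma teichmuller_expr (a : R) : teichmuller (p ^ m) zeta a -> a ^+ (p ^ m) = a.
Proof.
have q_gt0 : (0 < p ^ m)%N by rewrite expn_gt0 prime_gt0.
have zeta_q : zeta ^+ (p ^ m) = zeta.
  by rewrite -{1}(prednK q_gt0) exprS prim_expr_order // mulr1.
case/orP=> [/eqP ->|/existsP [i /eqP ->]]; first by rewrite expr0n gtn_eqF.
by rewrite exprAC zeta_q.
Qed.

(** Teichmueller elements are fixed by x |-> x ^+ (p ^ m), and already the
    p-th power depends only on the residue. *)
Lemma teichmuller_inj (a b : R) :
  teichmuller (p ^ m) zeta a -> teichmuller (p ^ m) zeta b ->
  mu a = mu b -> a = b.
Proof.
move=> /teichmuller_expr {2}<- /teichmuller_expr {2}<- /expr_residue_eq.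
by rewrite -(prednK m_ge1) expnS !exprM => ->.
Qed.

Lemma teichmuller_poly_inj (u v : {poly R}) :
  u \is a polyOver (teichmuller (p ^ m) zeta) ->
  v \is a polyOver (teichmuller (p ^ m) zeta) ->
  map_poly mu u = map_poly mu v -> u = v.
Proof.
have coef_T (w : {poly R}) i :
    w \is a polyOver (teichmuller (p ^ m) zeta) ->
    teichmuller (p ^ m) zeta w`_i.
  move=> /allP w_T; have [i_lt|i_ge] := ltnP i (size w).
    by apply: w_T; rewrite mem_nth.
  by rewrite nth_default // /teichmuller eqxx.
move=> u_T v_T eq_uv; apply/polyP => i; apply: teichmuller_inj; try exact: coef_T.
by rewrite -!coef_map eq_uv.
Qed.

End Teichmuller.

(** * Reduction modulo p of polynomials *)

Section Reduction.
Variables (p m : nat) (R : finComNzRingType) (F : finFieldType).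
Variables (mu : {rmorphism R -> F}).
Hypotheses (p_prime : prime p).
Hypotheses (R_galois : galois_ring_p2 p m R) (mu_res : residue_map p mu).

Local Notation "u ^mu" := (map_poly mu u) (at level 2, format "u ^mu").

Lemma map_poly_residue_surj (y : {poly F}) : exists u, u^mu = y.
Proof.
have [g gK] := choice (residue_map_surj mu_res).
exists (\poly_(i < size y) g y`_i); apply/polyP => i.
rewrite coef_map coef_poly; case: ltnP => [_|i_ge]; first exact: gK.
by rewrite raddf0 nth_default.
Qed.

Lemma map_poly_residue_ker (u : {poly R}) :
  u^mu = 0 <-> exists w, u = p%:R * w.
Proof.
split=> [u0|[w ->]]; last first.
  by rewrite rmorphM rmorph_nat -polyC_natr -(rmorph_nat mu) (residue_map_p mu_res) mul0r.
have dvd_p x : exists y, mu x = 0 -> x = p%:R * y.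
  have [/(residue_map_ker mu_res) [y xE]|x_neq0] := EM (mu x = 0).
    by exists y.
  by exists 0.
have [g gK] := choice dvd_p.
exists (\poly_(i < size u) g u`_i); apply/polyP => i.
rewrite -polyC_natr coefCM coef_poly; case: ltnP => [_|i_ge]; last first.
  by rewrite nth_default // mulr0.
by apply: gK; rewrite -coef_map u0 coef0.
Qed.

(** If x were a unit, p would be zero in R, whose characteristic is p ^ 2. *)
Lemma residue_torsion (x : R) : p%:R * x = 0 -> mu x = 0.
Proof.
move=> px0; apply/(residue_map_ker mu_res)/(galois_ring_max_ideal R_galois).
case=> y xy1; have p0 : p%:R = 0 :> R.
  by have := congr1 (fun a => a * y) px0; rewrite -mulrA xy1 mulr1 mul0r.
have := galois_ring_char R_galois p; rewrite p0 eqxx => /esym.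
rewrite expnS expn1 -{3}[p]muln1 dvdn_pmul2l ?prime_gt0 //.
by rewrite dvdn1 => /eqP p1; move: p_prime; rewrite p1.
Qed.

Lemma map_poly_residue_torsion (u : {poly R}) : p%:R * u = 0 -> u^mu = 0.
Proof.
move=> pu0; apply/polyP => i; rewrite coef_map coef0; apply: residue_torsion.
by rewrite -coefCM polyC_natr pu0 coef0.
Qed.

Lemma map_poly_residue_p : (p%:R : {poly R})^mu = 0.
Proof. by apply/map_poly_residue_ker; exists 1; rewrite mulr1. Qed.

Lemma poly_p2_eq0 : p%:R * p%:R = 0 :> {poly R}.
Proof. by rewrite -!polyC_natr -polyCM (galois_ring_p2_eq0 R_galois). Qed.

(** * Torsional degrees of two-generated ideals *)

Variables (f h beta : {poly R}) (t : nat).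
Hypotheses (f_monic : f \is monic) (h_monic : h \is monic).
Hypotheses (t_ge1 : (1 <= t)%N) (h_size : (1 < size h)%N).
Hypothesis f_def : f = h ^+ t + p%:R * beta.

Lemma size_monic_residue (u : {poly R}) : u \is monic -> size u^mu = size u.
Proof. by move=> /monicP u1; rewrite size_map_poly_id0 // u1 rmorph1 oner_eq0. Qed.

Lemma residue_modulus : f^mu = h^mu ^+ t.
Proof.
by rewrite f_def rmorphD rmorphM rmorphXn /= map_poly_residue_p mul0r addr0.
Qed.

Lemma residue_modulus_monic : f^mu \is monic.
Proof. exact: monic_map. Qed.

Lemma size_residue_modulus_gt1 : (1 < size f^mu)%N.
Proof.
rewrite -subn_gt0 subn1 residue_modulus size_exp muln_gt0 t_ge1 andbT.
by rewrite size_monic_residue // -subn1 subn_gt0.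
Qed.

Lemma size_modulus_gt1 : (1 < size f)%N.
Proof. by rewrite -size_monic_residue // size_residue_modulus_gt1. Qed.

Lemma red_quot_in_qpoly (u : {poly R}) :
  red_quot mu (in_qpoly f u) = in_qpoly f^mu u^mu.
Proof.
have : in_qpoly f (in_qpoly f u : {poly R}) = in_qpoly f u by rewrite in_qpolyK.
case/(in_qpoly_eqP _ _ f_monic size_modulus_gt1) => c uE.
apply/(in_qpoly_eqP _ _ residue_modulus_monic size_residue_modulus_gt1).
by exists c^mu; rewrite -rmorphM -rmorphD -uE.
Qed.

(** T <= t is essential: it makes hb ^+ T a divisor of the modulus hb ^+ t, so
    that divisibility does not depend on the representative x. *)
Lemma ideal_power_residueP (T : nat) (x : {poly F}) : (T <= t)%N ->
  ideal_gen [:: in_qpoly f^mu (h^mu ^+ T)] (in_qpoly f^mu x) <->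
  h^mu ^+ T %| x.
Proof.
move=> Tt; rewrite ideal_gen1P; split=> [[c]|/dvdpP [y ->]]; last first.
  by exists (in_qpoly f^mu y); rewrite in_qpolyM.
rewrite -(in_qpolyK c) -in_qpolyM.
case/(in_qpoly_eqP _ _ residue_modulus_monic size_residue_modulus_gt1) => d ->.
by rewrite dvdp_addl ?dvdp_mull // residue_modulus dvdp_exp2l.
Qed.

(** Any lift u of x may be used, not only the remainder modulo f: two lifts of
    the same class in the quotient differ by a multiple of f.  Uniqueness of T
    holds because hb ^+ T and hb ^+ T' divide each other only if T = T'. *)
Lemma torsional_degreeP (i T : nat) (C : set {poly %/ f}) : (T <= t)%N ->
  (forall x : {poly F},
     (exists u, C (p%:R ^+ i * in_qpoly f u) /\ u^mu = x) <-> h^mu ^+ T %| x) ->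
  torsional_degree p mu h t i C = T.
Proof.
move=> Tt CT.
have torE : @Tor p R F mu f i C = ideal_gen [:: in_qpoly f^mu (h^mu ^+ T)].
  apply/seteqP; split=> x.
    case=> u Cu <-; rewrite -(in_qpolyK u) red_quot_in_qpoly.
    apply/ideal_power_residueP => //; apply/CT; exists (u : {poly R}).
    by rewrite in_qpolyK.
  rewrite -(in_qpolyK x) => /(ideal_power_residueP _ Tt) /CT [u [Cu ux]].
  by exists (in_qpoly f u) => //; rewrite red_quot_in_qpoly ux.
apply: xget_unique => // T' [T't].
rewrite torE => /seteqP [sub sub'].
have hmu_gt1 : (1 < size h^mu)%N by rewrite size_monic_residue.
apply/eqP; rewrite eqn_leq -!(dvdp_Pexp2l _ _ hmu_gt1).
apply/andP; split.
  by apply/(ideal_power_residueP _ T't)/sub/ideal_power_residueP.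
by apply/(ideal_power_residueP _ Tt)/sub'/ideal_power_residueP.
Qed.

Lemma torsional_degree0 (k : nat) (g q : {poly R}) : (k <= t)%N ->
  g^mu = h^mu ^+ k -> q^mu = 0 ->
  torsional_degree p mu h t 0 (ideal_gen [:: in_qpoly f g; in_qpoly f q]) = k.
Proof.
move=> kt g_mu q_mu; apply: torsional_degreeP => // x; rewrite expr0.
split=> [[u [+ <-]]|/dvdpP [y ->]].
  rewrite mul1r => /(ideal_gen2_qpolyP _ _ _ f_monic size_modulus_gt1).
  case=> c [d [e ->]]; rewrite !(rmorphD, rmorphM) /= g_mu q_mu mulr0 addr0.
  by rewrite dvdp_add ?dvdp_mull // residue_modulus dvdp_exp2l.
have [c <-] := map_poly_residue_surj y.
exists (c * g); rewrite mul1r; split; last by rewrite rmorphM /= g_mu.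
apply/(ideal_gen2_qpolyP _ _ _ f_monic size_modulus_gt1).
by exists c, 0, 0; rewrite !mul0r !addr0.
Qed.

(** The relation defining membership, taken modulo p, determines the coefficient
    of the first generator up to a multiple of p; substituting it back leaves an
    equation in which every term is divisible by p. *)
Lemma torsion1_mem (k n : nat) (eps u : {poly R}) : (k <= t)%N -> (n <= k)%N ->
  ideal_gen [:: in_qpoly f (h ^+ k + p%:R * eps); in_qpoly f (p%:R * h ^+ n)]
    (p%:R ^+ 1 * in_qpoly f u) <->
  exists a b, u^mu = a * (beta^mu - h^mu ^+ (t - k) * eps^mu) + b * h^mu ^+ n.
Proof.
move=> kt nk; rewrite expr1 -(rmorph_nat (in_qpoly f)) -rmorphM /=.
rewrite (ideal_gen2_qpolyP _ _ _ f_monic size_modulus_gt1); split.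
  case=> c [b [e pu]].
  have /map_poly_residue_ker [c' c'E] : (c + e * h ^+ (t - k))^mu = 0.
    have hk_neq0 : h^mu ^+ k != 0 by exact/monic_neq0/monic_exp/monic_map.
    apply: (mulIf hk_neq0); rewrite mul0r; move/(congr1 (map_poly mu)): pu.
    rewrite f_def !(rmorphD, rmorphM, rmorphXn) /= map_poly_residue_p.
    rewrite !(mul0r, mulr0, addr0) mulrDl -mulrA -exprD subnK // => <- //.
  have cE : c = p%:R * c' - e * h ^+ (t - k) by rewrite -c'E addrK.
  exists e^mu, (c'^mu * h^mu ^+ (k - n) + b^mu).
  apply/eqP; rewrite -subr_eq0; apply/eqP.
  rewrite -!rmorphXn -rmorphM -rmorphB -rmorphM -rmorphM -rmorphD -rmorphM.
  rewrite -rmorphD -rmorphB.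
  apply: map_poly_residue_torsion.
  rewrite mulrBr pu cE f_def.
  have -> : h ^+ t = h ^+ (t - k) * h ^+ (k - n) * h ^+ n.
    by rewrite -mulrA -!exprD !subnK.
  have -> : h ^+ k = h ^+ (k - n) * h ^+ n by rewrite -exprD subnK.
  (* the terms in e cancel against f; only the product of p c' with p eps is left *)
  transitivity (p%:R * p%:R * (c' * eps)); first by ring.
  by rewrite poly_p2_eq0 mul0r.
case=> a [b].
have [a' <-] := map_poly_residue_surj a.
have [b' <-] := map_poly_residue_surj b => uE.
have /map_poly_residue_ker [w wE] :
    (u - (a' * (beta - h ^+ (t - k) * eps) + b' * h ^+ n))^mu = 0.
  by rewrite !(rmorphB, rmorphD, rmorphM, rmorphXn) /= uE subrr.
have -> : u = p%:R * w + (a' * (beta - h ^+ (t - k) * eps) + b' * h ^+ n).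
  by rewrite -wE subrK.
(* the multiple of f with coefficient a' produces a' beta; the first coefficient
   is chosen to cancel its leading part a' h ^+ t *)
exists (- (a' * h ^+ (t - k))), b', a'.
rewrite mulrDr mulrA poly_p2_eq0 mul0r add0r f_def.
have -> : h ^+ t = h ^+ (t - k) * h ^+ k by rewrite -exprD subnK.
by ring.
Qed.

Lemma torsional_degree1 (k n d : nat) (eps : {poly R}) (w : {poly F}) :
  irreducible_poly h^mu -> (k <= t)%N -> (n <= k)%N ->
  beta^mu - h^mu ^+ (t - k) * eps^mu = h^mu ^+ d * w ->
  ((d < n)%N -> ~~ (h^mu %| w)) ->
  torsional_degree p mu h t 1
    (ideal_gen [:: in_qpoly f (h ^+ k + p%:R * eps); in_qpoly f (p%:R * h ^+ n)])
  = minn d n.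
Proof.
move=> h_irr kt nk valD w_unit; apply: torsional_degreeP.
  by rewrite geq_min (leq_trans nk kt) orbT.
move=> x; rewrite -(ideal_primary_power h_irr _ w_unit); split.
  by case=> u [/(torsion1_mem _ _ kt nk) + <-]; rewrite valD.
have [u <-] := map_poly_residue_surj x => xE.
by exists u; split=> //; apply/torsion1_mem => //; rewrite valD.
Qed.

Lemma torsional_degree_pair (k n d : nat) (eps : {poly R}) (w : {poly F}) :
  irreducible_poly h^mu -> (k <= t)%N -> (n <= k)%N ->
  beta^mu - h^mu ^+ (t - k) * eps^mu = h^mu ^+ d * w ->
  ((d < n)%N -> ~~ (h^mu %| w)) ->
  let C :=
    ideal_gen [:: in_qpoly f (h ^+ k + p%:R * eps); in_qpoly f (p%:R * h ^+ n)] in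
  torsional_degree p mu h t 0 C = k /\ torsional_degree p mu h t 1 C = minn d n.
Proof.
move=> h_irr kt nk valD w_unit C; split; last exact: torsional_degree1 valD _.
apply: torsional_degree0 => //.
  by rewrite rmorphD rmorphM rmorphXn /= map_poly_residue_p mul0r addr0.
by rewrite rmorphM /= map_poly_residue_p mul0r.
Qed.

(** p times the generator is p h ^+ k, because p ^ 2 = 0; adjoining it gives a
    two-generated ideal with n = k. *)
Lemma torsional_degree_principal (k d : nat) (eps : {poly R}) (w : {poly F}) :
  irreducible_poly h^mu -> (k <= t)%N ->
  beta^mu - h^mu ^+ (t - k) * eps^mu = h^mu ^+ d * w ->
  ((d < k)%N -> ~~ (h^mu %| w)) ->
  let C := ideal_gen [:: in_qpoly f (h ^+ k + p%:R * eps)] in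
  torsional_degree p mu h t 0 C = k /\ torsional_degree p mu h t 1 C = minn d k.
Proof.
move=> h_irr kt valD w_unit; rewrite (ideal_gen_absorb _ p%:R).
rewrite -(rmorph_nat (in_qpoly f)) -rmorphM /= mulrDr mulrA poly_p2_eq0 mul0r addr0.
exact: torsional_degree_pair valD w_unit.
Qed.

End Reduction.

(** * The least index at which two digit sequences differ *)

Lemma bigminn_seqP (I : eqType) (r : seq I) (P : pred I) (E : I -> nat) (t : nat) :
  let z := \big[minn/t]_(j <- r | P j) E j in
  (forall j, j \in r -> P j -> (z <= E j)%N) /\
  (z = t \/ exists2 j, P j & z = E j).
Proof.
elim: r => [|i r [lb attained]] /=; first by rewrite big_nil; split=> //; left.
rewrite big_cons; case: ifP => Pi; last first.
  by split=> // j; rewrite inE => /orP[/eqP ->|/lb //]; rewrite Pi.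
split=> [j|]; last by case: leqP => _; [right; exists i|].
rewrite inE => /orP[/eqP -> _|jr Pj]; first exact: geq_minl.
by rewrite geq_min lb ?orbT.
Qed.

Theorem lemma4p4
  (p m : nat) (p_prime : prime p) (m_ge1 : (1 <= m)%N)
  (R : finComNzRingType) (R_galois : galois_ring_p2 p m R)
  (F : finFieldType) (mu : {rmorphism R -> F}) (mu_res : residue_map p mu)
  (zeta : R) (zeta_prim : (p ^ m).-1.-primitive_root zeta)
  (f h beta beta' : {poly R}) (t v : nat) (gamma : nat -> {poly R})
  (f_monic : f \is monic) (f_regular : GRing.lreg f)
  (f_primary : primary_elt f) (f_nonunit : ~ invertible f)
  (t_ge1 : (1 <= t)%N)
  (h_monic : h \is monic) (h_basic : basic_irreducible mu h)
  (f_def : f = h ^+ t + p%:R * beta)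
  (beta_neq0 : beta != 0)
  (beta_deg : ((size beta).-1 < t * (size h).-1)%N)
  (v_lt_t : (v < t)%N)
  (beta_def : beta = h ^+ v * beta')
  (beta'_def : beta' = \sum_(j < t - v) gamma j * h ^+ j)
  (gamma_teich : forall j, (j < t - v)%N ->
     gamma j \is a polyOver (teichmuller (p ^ m) zeta))
  (gamma_deg : forall j, (j < t - v)%N -> (size (gamma j) < size h)%N)
  (gamma0_neq0 : gamma 0%N != 0)
  (C : set {poly %/ f}) (C_ideal : is_ideal C)
  (k l n : nat) (k_lt_t : (k < t)%N) (l_lt_t : (l < t)%N) (n_lt_t : (n < t)%N)
  (n_lt_k : (n < k)%N) (l_lt_k : (l < k)%N)
  (delta : {poly R}) (eta : nat -> {poly R})
  (delta_def : delta = \sum_(j < k - l) eta j * h ^+ j)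
  (eta_teich : forall j, (j < k - l)%N ->
     eta j \is a polyOver (teichmuller (p ^ m) zeta))
  (eta_deg : forall j, (j < k - l)%N -> (size (eta j) < size h)%N)
  (eta0_neq0 : eta 0%N != 0) :
  let z := \big[minn/t]_(j < t - v | gamma j != eta j) (j : nat) in
  let T_ := fun i => torsional_degree p mu h t i C in
  let g1 := in_qpoly f (h ^+ k) in
  let g2 := in_qpoly f (h ^+ k + p%:R * h ^+ l * delta) in
  let g3 := in_qpoly f (p%:R * h ^+ n) in
  [/\ C = ideal_gen [:: g1] ->
        T_ 0%N = k /\ T_ 1%N = minn k v,
      C = ideal_gen [:: g2] ->
        T_ 0%N = k /\
        T_ 1%N = (if v != t - k + l
                  then minn k (minn v (t - k + l))
                  else minn k (v + z))%N,
      C = ideal_gen [:: g1; g3] ->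
        T_ 0%N = k /\ T_ 1%N = minn k (minn v n)
    & C = ideal_gen [:: g2; g3] ->
        T_ 0%N = k /\
        T_ 1%N = (if v != t - k + l
                  then minn k (minn v (minn (t - k + l) n))
                  else minn k (minn (v + z) n))%N].
Proof.
move=> z T_ g1 g2 g3.
have h_irr := h_basic.2.
have h_size : (1 < size h)%N.
  by rewrite -(size_monic_residue mu h_monic); case: h_irr.
set hb := map_poly mu h in h_irr.
have digit_size (a : {poly R}) :
    (size a < size h)%N -> (size (map_poly mu a) < size hb)%N.
  by rewrite /hb (size_monic_residue mu h_monic); exact/leq_ltn_trans/size_poly.
have T0 : 0 \is a polyOver (teichmuller (p ^ m) zeta).
  by apply/allP => a; rewrite polyseq0.
have digit_inj := teichmuller_poly_inj R_galois mu_res p_prime m_ge1 zeta_prim.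
have digit_neq0 (a : {poly R}) :
    a \is a polyOver (teichmuller (p ^ m) zeta) -> a != 0 -> map_poly mu a != 0.
  move=> aT; apply: contra_neq => a0; apply: digit_inj => //.
  by rewrite a0 rmorph0.
have digits_unit N (a : nat -> {poly R}) : (0 < N)%N ->
    (forall j, (j < N)%N -> a j \is a polyOver (teichmuller (p ^ m) zeta)) ->
    (forall j, (j < N)%N -> (size (a j) < size h)%N) -> a 0%N != 0 ->
    ~~ (hb %| map_poly mu (\sum_(j < N) a j * h ^+ j)).
  move=> N0 aT a_size a0.
  have [] // := @lowest_digit _ hb N 0 (fun j => map_poly mu (a j)).
  - by move=> j /a_size; apply: digit_size.
  - exact: digit_neq0 (aT _ N0) a0.
  rewrite expr0 => w + hw; rewrite mul1r => wE; move: hw; rewrite -wE rmorph_sum.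
  by congr (~~ (_ %| _)); apply: eq_bigr => j _; rewrite /= rmorphM rmorphXn.
have betab : map_poly mu beta = hb ^+ v * map_poly mu beta'.
  by rewrite beta_def rmorphM rmorphXn.
have betab_unit : ~~ (hb %| map_poly mu beta').
  by rewrite beta'_def; apply: digits_unit => //; rewrite subn_gt0.
have deltab_unit : ~~ (hb %| map_poly mu delta).
  by rewrite delta_def; apply: digits_unit => //; rewrite subn_gt0.
have val1 : map_poly mu beta - hb ^+ (t - k) * map_poly mu 0 =
    hb ^+ v * map_poly mu beta'.
  by rewrite rmorph0 mulr0 subr0.
pose d := if v != (t - k + l)%N then minn v (t - k + l) else (v + z)%N.
(* d is the valuation of D; when D = 0 it is v + t, with w = 0 *)
have [w val2 w_unit] : exists2 w, map_poly mu beta -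
    hb ^+ (t - k) * map_poly mu (h ^+ l * delta) = hb ^+ d * w &
    (d < t)%N -> ~~ (hb %| w).
  rewrite rmorphM rmorphXn /= mulrA -exprD betab /d.
  case: eqVneq => [v_eq|v_neq] /=; last first.
    have [w ? w_unit] := valuation_sub betab_unit deltab_unit v_neq.
    by exists w.
  have N_eq : (k - l = t - v)%N by lia.
  have subE : map_poly mu beta' - map_poly mu delta =
      \sum_(j < t - v) map_poly mu (gamma j - eta j) * hb ^+ j.
    rewrite beta'_def delta_def N_eq !rmorph_sum -sumrB; apply: eq_bigr => j _.
    by rewrite !rmorphM rmorphXn rmorphB mulrBl.
  rewrite -v_eq -mulrBr subE exprD.
  have [z_le z_att] : (forall j : 'I_(t - v), gamma j != eta j -> (z <= j)%N) /\
      (z = t \/ exists2 j : 'I_(t - v), gamma j != eta j & z = j).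
    have [z_le z_att] := bigminn_seqP (index_enum 'I_(t - v))
      (fun j => gamma j != eta j) (fun j => j : nat) t.
    by split=> // j; apply: z_le; rewrite mem_index_enum.
  have low j : (j < t - v)%N -> (j < z)%N -> gamma j = eta j.
    move=> jN; apply: contraTeq => neq_j; rewrite -leqNgt.
    exact: (z_le (Ordinal jN)).
  (* z = t means that no digits differ, since every index is below t - v *)
  case: z_att => [z_t|[j0 neq_j0 z_j0]].
    exists 0; last by rewrite ltnNge z_t leq_addl.
    rewrite mulr0 big1 ?mulr0 // => j _; rewrite low ?subrr ?rmorph0 ?mul0r //.
    by rewrite z_t; apply: leq_trans (ltn_ord j) (leq_subr _ _).
  have zN : (z < t - v)%N by rewrite z_j0.
  have [] := @lowest_digit _ hb (t - v) z (fun j => map_poly mu (gamma j - eta j)).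
  - move=> j jN; apply: digit_size; apply: leq_ltn_trans (size_polyD _ _) _.
    by rewrite size_polyN gtn_max gamma_deg // eta_deg // N_eq.
  - exact: zN.
  - rewrite rmorphB subr_eq0; apply: contra_neq neq_j0; rewrite -z_j0.
    by apply: digit_inj; [apply: gamma_teich | apply: eta_teich; rewrite N_eq].
  - by move=> j jz; rewrite low ?subrr ?rmorph0 // (ltn_trans jz).
  by move=> w -> w_unit; exists w => //; rewrite mulrA.
have kt := ltnW k_lt_t; have nk := ltnW n_lt_k.
have pair n' d' eps w' := @torsional_degree_pair _ _ _ _ _ p_prime R_galois mu_res
  f h beta t f_monic h_monic t_ge1 h_size f_def k n' d' eps w' h_irr kt.
have principal d' eps w' := @torsional_degree_principal _ _ _ _ _ p_prime R_galois mu_res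
  f h beta t f_monic h_monic t_ge1 h_size f_def k d' eps w' h_irr kt.
have g1E : g1 = in_qpoly f (h ^+ k + p%:R * 0) by rewrite mulr0 addr0.
have g2E : g2 = in_qpoly f (h ^+ k + p%:R * (h ^+ l * delta)) by rewrite mulrA.
split=> CE; rewrite /T_ CE.
- by rewrite g1E minnC; apply: principal val1 _.
- rewrite g2E; have [|-> ->] := principal _ _ _ val2.
    by move=> dk; apply: w_unit; apply: ltn_trans dk k_lt_t.
  by split=> //; rewrite /d; case: ifP => _; lia.
- rewrite g1E; have [|-> ->] := pair _ _ _ _ nk val1; first by [].
  by split=> //; lia.
- rewrite g2E; have [|-> ->] := pair _ _ _ _ nk val2.
    by move=> dn; apply: w_unit; apply: ltn_trans dn n_lt_t.
  by split=> //; rewrite /d; case: ifP => _; lia.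
Qed.
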